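(* For all integers $1\le d<\infty$, all non-empty $u\subseteq\{1,\dots,d\}$ and all $\boldsymbol{k}\in\mathbb{N}_0^u$, the gain coefficients of the Halton points satisfy $$\sup_{n\in\mathbb{N}}G_{u,\boldsymbol{k}}(n)=\sup_{n\in\mathbb{N}}G_{u,\boldsymbol{0}}(n),$$ where $\boldsymbol{0}\in\mathbb{N}_0^u$ is the zero vector.
   Context: $\mathbb{N}=\{1,2,\dots\}$, $\mathbb{N}_0=\mathbb{N}\cup\{0\}$. For $j\in\mathbb{N}$, $b_j$ is the $j$-th prime ($b_1=2,b_2=3,b_3=5,\dots$). For $i\in\mathbb{N}_0$ write $i=\sum_{\ell\ge1}a_{ij\ell}b_j^{\ell-1}$ with base-$b_j$ digits $a_{ij\ell}\in\{0,\dots,b_j-1\}$; the (unscrambled) Halton points are $\boldsymbol{a}_i=(a_{i1},\dots,a_{id})\in[0,1)^d$, $i\in\mathbb{N}_0$, with $a_{ij}=\sum_{\ell\ge1}a_{ij\ell}b_j^{-\ell}$. For $u\subseteq\{1,\dots,d\}$, $\mathbb{N}_0^u$ is the set of vectors $\boldsymbol{k}=(k_j)_{j\in u}$ of nonnegative integers indexed by $u$. For non-empty $u\subseteq\{1,\dots,d\}$, $\boldsymbol{k}\in\mathbb{N}_0^u$ and $n\in\mathbb{N}$, the gain coefficient is $$G_{u,\boldsymbol{k}}(n)=\frac1n\prod_{j\in u}\frac1{b_j-1}\ \sum_{i=0}^{n-1}\sum_{i'=0}^{n-1}\prod_{j\in u}\Bigl(b_j\mathbf{1}\{\lfloor b_j^{k_j+1}a_{ij}\rfloor=\lfloor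 b_j^{k_j+1}a_{i'j}\rfloor\}-\mathbf{1}\{\lfloor b_j^{k_j}a_{ij}\rfloor=\lfloor b_j^{k_j}a_{i'j}\rfloor\}\Bigr),$$ where $\mathbf{1}\{A\}$ is $1$ if $A$ holds and $0$ otherwise. *)

(* Defs.v *)
From HB Require Import structures.
From mathcomp Require Import all_boot all_order all_algebra.
From mathcomp Require Import all_classical all_reals all_analysis.

Set Implicit Arguments.
Unset Strict Implicit.
Unset Printing Implicit Defensive.

Import Order.TTheory GRing.Theory Num.Theory.
Import numFieldNormedType.Exports.

Local Open Scope classical_set_scope.
Local Open Scope ring_scope.

(** Coordinates are numbered from 0: [j : 'I_d] stands for the coordinate
    [j + 1] in 1..d, whose base is the (j+1)-th prime [nth_prime j]. *)

Lemma next_prime_ex (m : nat) : exists p : nat, (m < p)%N && prime p.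
Proof. by have [p ltmp pr_p] := prime_above m; exists p; rewrite ltmp. Qed.

Definition next_prime (m : nat) : nat := ex_minn (next_prime_ex m).

Definition nth_prime (j : nat) : nat := iter j next_prime 2%N.

(** [digit b i l], meant for [1 <= l], is the coefficient of [b ^ (l - 1)] in
    the base-[b] expansion of [i]; see [digit_ltn] and [digit_expansion]. *)
Definition digit (b i l : nat) : nat := ((i %/ b ^ l.-1) %% b)%N.

Lemma digit_ltn (b i l : nat) : (0 < b)%N -> (digit b i l < b)%N.
Proof. by move=> b_gt0; rewrite ltn_mod. Qed.

Lemma digit_expansion (b i m : nat) : (i < b ^ m)%N ->
  i = (\sum_(1 <= l < m.+1) digit b i l * b ^ l.-1)%N.
Proof.
move=> lt_i; rewrite -[LHS](modn_small lt_i) => {lt_i}.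
elim: m => [|m IHm]; first by rewrite modn1 big_geq.
rewrite big_nat_recr //= -IHm /digit /=.
by rewrite [LHS](divn_eq _ (b ^ m)) modn_divl -expnS modn_dvdm ?dvdn_exp2l // addnC.
Qed.

(** The infinite sum is a limit of partial sums in [R]; only finitely many of
    its terms are nonzero. *)
Definition halton (R : realType) (d i : nat) (j : 'I_d) : R :=
  limn (fun m : nat =>
    \sum_(1 <= l < m) (digit (nth_prime j) i l)%:R * (nth_prime j)%:R ^- l : R).

Definition same_cell (R : realType) (b m : nat) (x y : R) : R :=
  (Num.floor (b%:R ^+ m * x) == Num.floor (b%:R ^+ m * y))%:R.

(** Vectors indexed by [u] are represented by total functions [k] on ['I_d];
    only the values of [k] on [u] are used. *)
Definition gain (R : realType) (d : nat) (u : {set 'I_d}) (k : 'I_d -> nat)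
    (n : nat) : R :=
  n%:R^-1 * (\prod_(j in u) ((nth_prime j)%:R - 1)^-1) *
  \sum_(0 <= i < n) \sum_(0 <= i' < n) \prod_(j in u)
    ((nth_prime j)%:R *
       same_cell (nth_prime j) (k j).+1 (halton R i j) (halton R i' j)
     - same_cell (nth_prime j) (k j) (halton R i j) (halton R i' j)).

(* Main.v *)
Require Import Defs.
From mathcomp Require Import all_boot all_order all_algebra.
From mathcomp Require Import all_classical all_reals all_analysis.

Import Order.TTheory GRing.Theory Num.Theory.
Import numFieldNormedType.Exports.

Local Open Scope classical_set_scope.
Local Open Scope ring_scope.

(** Two Halton points share the [j]-th cell at level [m] iff their indices agree
    mod [b_j ^ m].  Put [K = \prod_(j in u) b_j ^ k_j].  By the Chinese remainder
    theorem the kernel of [G_k] vanishes unless [i = i' mod K], and on a residue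
    class mod [K] it is the kernel of [G_0] evaluated at the quotients.  Hence,
    for [n = q K + s] with [s < K],
      [n G_k(n) = (K - s) q G_0(q) + s (q + 1) G_0(q + 1)],
    so [G_k(n)] is a weighted mean of [G_0(q)] and [G_0(q + 1)], and
    [G_k(K n) = G_0(n)]. *)

Lemma nth_prime_prime j : prime (nth_prime j).
Proof.
case: j => [//|j]; rewrite /nth_prime iterS /next_prime.
by case: ex_minnP => p /andP[].
Qed.

(** [next_prime] exceeds its argument, so the sequence is strictly increasing. *)
Lemma nth_prime_inj : injective nth_prime.
Proof.
apply: incn_inj; apply: leq_mono; apply: homo_ltn; first exact: ltn_trans.
move=> j; rewrite [X in (_ < X)%N]/nth_prime iterS -/(nth_prime j) /next_prime.
by case: ex_minnP => p /andP[].
Qed.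

Lemma coprime_nth_prime j l : j != l -> coprime (nth_prime j) (nth_prime l).
Proof.
move=> njl; rewrite prime_coprime ?nth_prime_prime//.
rewrite dvdn_prime2 ?nth_prime_prime//.
by apply: contra njl => /eqP/nth_prime_inj ->.
Qed.

(** Digit reversal: the first [m] digits of [i], with digit 1 now the most significant. For a prime
    base this is the floor of [b ^ m] times the Halton coordinate. *)
Fixpoint leading_digits (b i m : nat) : nat :=
  if m is m'.+1 then (leading_digits b i m' * b + digit b i m)%N else 0%N.

Lemma leading_digits_divn b i m t : (0 < b)%N ->
  (leading_digits b i (m + t) %/ b ^ t)%N = leading_digits b i m.
Proof.
move=> b_gt0; elim: t => [|t IHt]; first by rewrite addn0 divn1.
rewrite addnS expnS divnMA /= divnMDl// -[RHS]IHt.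
by rewrite [(digit _ _ _ %/ _)%N]divn_small ?addn0 ?digit_ltn.
Qed.

Lemma leading_digits_eq b i i' m : (0 < b)%N ->
  (leading_digits b i m == leading_digits b i' m) = (i == i' %[mod b ^ m])%N.
Proof.
move=> b_gt0; elim: m => [|m IHm]; first by rewrite !modn1 !eqxx.
have modE x : (x %% b ^ m.+1 = digit b x m.+1 * b ^ m + x %% b ^ m)%N.
  rewrite [LHS](divn_eq _ (b ^ m)) /digit /= expnS modn_divl.
  by rewrite (modn_dvdm _ (dvdn_mull _ (dvdnn _))).
(* Uniqueness of Euclidean division, used with [c = b] to split off the last reversed digit and with
   [c = b ^ m] to split off the top digit of the residue. *)
have pairE c q q' r r' : (r < c)%N -> (r' < c)%N ->
    (q * c + r == q' * c + r')%N = (q == q') && (r == r').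
  move=> ltr ltr'; apply/eqP/andP => [e|[/eqP-> /eqP->]//].
  have c_gt0 := leq_ltn_trans (leq0n _) ltr.
  have := congr1 (divn^~ c) e; have := congr1 (modn^~ c) e.
  rewrite /= !modnMDl !divnMDl// !modn_small// !divn_small// !addn0.
  by move=> -> ->.
by rewrite !modE /= !pairE ?digit_ltn ?ltn_mod ?expn_gt0 ?b_gt0// IHm andbC.
Qed.

Section Halton.
Variables (R : realType) (d : nat).
Implicit Types (i m n : nat) (j : 'I_d) (u : {set 'I_d}) (k : 'I_d -> nat).

Local Notation b := nth_prime.

(** Since [i <= m < b ^ m], the digits of [i] past position [m] vanish, so the partial sums are
    constant from there on. *)
Lemma haltonE i j m : (i <= m)%N ->
  halton R i j = (leading_digits (b j) i m)%:R / (b j)%:R ^+ m.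
Proof.
have b_gt1 := prime_gt1 (nth_prime_prime j).
have b_neq0 : (b j)%:R != 0 :> R by rewrite pnatr_eq0 -lt0n (ltnW b_gt1).
move=> le_im; have partialE n :
    \sum_(1 <= l < n.+1) (digit (b j) i l)%:R * (b j)%:R ^- l =
    (leading_digits (b j) i n)%:R / (b j)%:R ^+ n :> R.
  elim: n => [|n IHn]; first by rewrite big_geq// mul0r.
  rewrite big_nat_recr//= IHn natrD natrM mulrDl exprSr; congr (_ + _).
  by rewrite invfM mulrACA divff// mulr1.
rewrite -partialE; apply: lim_near_cst => //.
exists m.+1 => // n /= lt_mn; rewrite (big_cat_nat _ (n := m.+1))//=.
rewrite [X in _ + X]big_nat_cond [X in _ + X]big1 ?addr0// => l.
rewrite andbT => /andP[lt_ml _].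
rewrite /digit divn_small ?mod0n ?mul0r//.
have /prednK <- : (0 < l)%N by exact: leq_ltn_trans lt_ml.
apply: leq_ltn_trans (ltn_expl _ b_gt1) => /=.
by rewrite (leq_trans le_im)// -ltnS (ltn_predK lt_ml).
Qed.

Lemma floor_natr_div n m : Num.floor (n%:R / m%:R : R) = (n %/ m)%N.
Proof.
(* Division by zero returns 0 on both sides. *)
have [->|m_gt0] := posnP m; first by rewrite invr0 mulr0 floor0 divn0.
have m_gt0' : 0 < m%:R :> R by rewrite ltr0n.
apply: floor_def; rewrite -PoszD addn1 -!pmulrn ler_pdivlMr// ltr_pdivrMr//.
by rewrite -!natrM ler_nat ltr_nat leq_divM ltn_ceil.
Qed.

Lemma same_cell_halton m i i' j :
  same_cell (b j) m (halton R i j) (halton R i' j) =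
  (i == i' %[mod b j ^ m])%N%:R.
Proof.
have b_gt0 := prime_gt0 (nth_prime_prime j).
have b_neq0 : (b j)%:R != 0 :> R by rewrite pnatr_eq0 -lt0n.
have floorE x : Num.floor ((b j)%:R ^+ m * halton R x j) =
    leading_digits (b j) x m.
  (* Level [m + x] captures every digit of [x]; the floor then drops the last [x] of the reversed
     digits. *)
  rewrite (@haltonE _ _ (m + x)) ?leq_addl// exprD invfM mulrCA.
  rewrite mulVKf ?expf_neq0// -natrX floor_natr_div.
  by rewrite leading_digits_divn.
by rewrite /same_cell !floorE eqz_nat leading_digits_eq.
Qed.

Definition gain_kernel u k i i' : R :=
  \prod_(j in u) ((b j)%:R * (i == i' %[mod b j ^ (k j).+1])%N%:R
                  - (i == i' %[mod b j ^ k j])%N%:R).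

Definition gain_sum u k n : R :=
  \sum_(0 <= i < n) \sum_(0 <= i' < n) gain_kernel u k i i'.

Lemma gainE u k n : gain R u k n =
  (\prod_(j in u) ((b j)%:R - 1)^-1) * (n%:R^-1 * gain_sum u k n).
Proof.
rewrite /gain -mulrA mulrCA; congr (_ * (_ * _)).
by do 2![apply: eq_bigr => ? _]; apply: eq_bigr => j _; rewrite !same_cell_halton.
Qed.

Definition modulus u k : nat :=
  (\prod_(j in u) b j ^ k j)%N.

Lemma modulus_gt0 u k : (0 < modulus u k)%N.
Proof.
by apply: prodn_cond_gt0 => j _; rewrite expn_gt0 prime_gt0 ?nth_prime_prime.
Qed.

(** Chinese remainder theorem, through divisibility of the difference [i - i'] by pairwise coprime
    prime powers. *)
Lemma modulus_eq u k i i' :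
  (forall j, j \in u -> i == i' %[mod b j ^ k j])%N -> i == i' %[mod modulus u k].
Proof.
wlog le_i : i i' / (i' <= i)%N => [hw|].
  case/orP: (leq_total i' i) => [|le_i eq_i]; first exact: hw.
  by rewrite eq_sym hw// => j /eq_i; rewrite eq_sym.
move=> eq_i; rewrite eqn_mod_dvd//; apply/unstable.Gauss_dvd_prod; last first.
  by move=> j _ uj; rewrite -eqn_mod_dvd ?eq_i.
(* Pairwise coprimality comes from the enumeration of the indices being duplicate-free. *)
rewrite pairwise_map; have := index_enum_uniq 'I_d.
rewrite uniq_pairwise => /(pairwise_filter (mem u)).
apply: sub_pairwise => j l njl /=.
by rewrite coprimeXl ?coprimeXr ?coprime_nth_prime.
Qed.

Lemma gain_kernel_modulus u k q q' r r' :
  (r < modulus u k)%N -> (r' < modulus u k)%N ->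
  gain_kernel u k (q * modulus u k + r) (q' * modulus u k + r') =
  (r == r')%:R * gain_kernel u (fun=> 0%N) q q'.
Proof.
set K := modulus u k => ltr ltr'.
have dvdK j : j \in u -> (b j ^ k j %| K)%N.
  by move=> uj; rewrite /K /modulus (bigD1 j)//= dvdn_mulr.
have modK j q0 r0 : j \in u -> (q0 * K + r0 = r0 %[mod b j ^ k j])%N.
  by move=> uj; have /dvdnP[c ->] := dvdK j uj; rewrite mulnA modnMDl.
have [<-{ltr'}|neq] := eqVneq r r'; last first.
  rewrite mul0r; have [j /andP[uj nj]] :
      exists j, (j \in u) && (r != r' %[mod b j ^ k j])%N.
    apply/existsP; apply: contraNT neq; rewrite negb_exists => /forallP eqr.
    rewrite -(modn_small ltr) -(modn_small ltr') modulus_eq// => j uj.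
    by have := eqr j; rewrite uj negbK.
  (* The factor at [j] is zero: the coarse congruence fails, hence so does the finer one, which
     implies it. *)
  rewrite /gain_kernel (bigD1 j)//= !modK// (negPf nj) subr0.
  case: eqP => [e|_]; last by rewrite mulr0 mul0r.
  have dvdb : (b j ^ k j %| b j ^ (k j).+1)%N by rewrite dvdn_exp2l.
  have /eqP := congr1 (modn^~ (b j ^ k j)%N) e.
  by rewrite !(modn_dvdm _ dvdb) !modK// (negPf nj).
rewrite mul1r; apply: eq_bigr => j uj; rewrite !modK// eqxx expn1 expn0 !modn1.
congr (_ * _%:R - _); rewrite eqn_modDr.
(* Cancelling [b j ^ k j] leaves a congruence mod [b j] between multiples of the cofactor [c], which
   is invertible mod [b j]. *)
have KE : K = (b j ^ k j * \prod_(l in u | l != j) b l ^ k l)%N.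
  by rewrite /K /modulus (bigD1 j).
rewrite KE expnSr !(mulnCA _ (b j ^ k j)%N) -!muln_modr.
rewrite eqn_pmul2l ?expn_gt0 ?prime_gt0 ?nth_prime_prime//.
set c := (\prod_(l in u | l != j) _)%N.
have cop : coprime (b j) c.
  rewrite coprime_sym /c; elim/big_ind: _ => [|x y|l /andP[_ nlj]].
  - exact: coprime1n.
  - by rewrite coprimeMl => -> ->.
  - by rewrite coprimeXl ?coprime_nth_prime.
clear -cop; wlog le_q : q q' / (q' <= q)%N => [hw|].
  case/orP: (leq_total q' q) => [|le_q]; first exact: hw.
  by rewrite eq_sym hw// eq_sym.
by rewrite !eqn_mod_dvd ?leq_mul// -mulnBl Gauss_dvdl.
Qed.

(** Below [n], each class mod [K] has [n %/ K] members, and one more exactly when [r < n %% K]. *)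
Lemma sum_residues (K n : nat) (F : nat -> R) : (0 < K)%N ->
  \sum_(0 <= i < n) F i =
  \sum_(r < K) \sum_(0 <= q < n %/ K + (r < n %% K)) F (q * K + r)%N.
Proof.
move=> K_gt0; rewrite {1}(divn_eq n K).
set q0 := (n %/ K)%N; set s := (n %% K)%N.
have le_sK : (s <= K)%N by rewrite ltnW ?ltn_pmod.
(* The range is cut into [q0] full blocks of length [K] and a last block of length [s]. *)
rewrite (big_cat_nat _ (n := (q0 * K)%N)) ?leq_addr//= big_nat_mul.
rewrite [RHS](eq_bigr (fun r : 'I_K => \sum_(0 <= q < q0) F (q * K + r)%N +
    if (r < s)%N then F (q0 * K + r)%N else 0)) => [|r _]; last first.
  by case: ltnP => _; rewrite ?addn1 ?addn0 ?addr0// big_nat_recr.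
rewrite big_split /=; congr (_ + _).
  rewrite exchange_big /=; apply: eq_bigr => q _.
  rewrite mulSn -{1}[(q * K)%N]add0n big_addn addnK big_mkord.
  by apply: eq_bigr => r _; rewrite addnC.
rewrite -big_mkcond /= (big_ord_narrow le_sK) /=.
rewrite -{1}[(q0 * K)%N]add0n big_addn addKn big_mkord.
by apply: eq_bigr => r _; rewrite addnC.
Qed.

Lemma gain_sum_modulus u k n (q := (n %/ modulus u k)%N) (s := (n %% modulus u k)%N) :
  gain_sum u k n = (modulus u k - s)%:R * gain_sum u (fun=> 0%N) q
                 + s%:R * gain_sum u (fun=> 0%N) q.+1.
Proof.
have K_gt0 := modulus_gt0 u k; set K := modulus u k in q s K_gt0 *.
have -> : gain_sum u k n =
    \sum_(r < K) gain_sum u (fun=> 0%N) (q + (r < s)).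
  rewrite /gain_sum (sum_residues _ n _ K_gt0); apply: eq_bigr => r _.
  (* For a first index in class [r], only second indices in the same class contribute. *)
  apply: eq_bigr => m _; rewrite (sum_residues _ n _ K_gt0) (bigD1 r)//=.
  rewrite [X in _ + X]big1 ?addr0 => [|r' nr].
    by apply: eq_bigr => m' _; rewrite gain_kernel_modulus// eqxx mul1r.
  by apply: big1 => m' _; rewrite gain_kernel_modulus// eq_sym val_eqE (negPf nr) mul0r.
have le_sK : (s <= K)%N by rewrite ltnW ?ltn_pmod.
rewrite -(big_mkord xpredT (fun r => gain_sum u (fun=> 0%N) (q + (r < s)))).
rewrite (big_cat_nat _ (n := s))//= addrC; congr (_ + _).
  rewrite (eq_big_nat _ _ (F2 := fun=> gain_sum u (fun=> 0%N) q)).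
    by rewrite sumr_const_nat mulr_natl.
  by move=> r /andP[le_sr _]; rewrite ltnNge le_sr addn0.
rewrite (eq_big_nat _ _ (F2 := fun=> gain_sum u (fun=> 0%N) q.+1)).
  by rewrite sumr_const_nat subn0 mulr_natl.
by move=> r /andP[_ ->]; rewrite addn1.
Qed.

(** Each of the [K] residue classes has exactly [n] members, and the factor [K] cancels against the
    normalisation. *)
Lemma gain_modulus_mul u k n :
  gain R u k (modulus u k * n) = gain R u (fun=> 0%N) n.
Proof.
have K_gt0 := modulus_gt0 u k.
rewrite !gainE gain_sum_modulus mulKn// modnMr subn0 mul0r addr0 natrM invfM.
by rewrite mulrACA mulVf ?mul1r// pnatr_eq0 -lt0n.
Qed.

Lemma gain_le_max u k n : (0 < n)%N ->
  exists2 m, (0 < m)%N & gain R u k n <= gain R u (fun=> 0%N) m.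
Proof.
move=> n_gt0; have K_gt0 := modulus_gt0 u k; set K := modulus u k in K_gt0.
pose q := (n %/ K)%N; pose s := (n %% K)%N.
set c := \prod_(j in u) ((b j)%:R - 1 : R)^-1.
have sumE m : (0 < m)%N ->
    c * gain_sum u (fun=> 0%N) m = m%:R * gain R u (fun=> 0%N) m.
  by move=> m_gt0; rewrite gainE mulrCA mulVKf// pnatr_eq0 -lt0n.
have gE : n%:R * gain R u k n =
    (K - s)%:R * (c * gain_sum u (fun=> 0%N) q)
    + s%:R * (q.+1%:R * gain R u (fun=> 0%N) q.+1).
  rewrite -sumE// gainE -/c gain_sum_modulus -/q -/s -/K.
  rewrite mulrCA mulVKf ?pnatr_eq0 -?lt0n// mulrDr.
  by rewrite ![c * (_ * _)]mulrCA.
(* The weights of [G_0(q)] and [G_0(q + 1)] add up to [n], so the larger of the two values bounds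
   [G_k(n)]. *)
have nE : n%:R = (K - s)%:R * q%:R + s%:R * q.+1%:R :> R.
  rewrite -!natrM -natrD; congr _%:R.
  rewrite mulnS mulnBl addnCA subnK ?leq_mul2r ?[(s <= K)%N]ltnW ?ltn_pmod ?orbT//.
  by rewrite mulnC addnC -divn_eq.
have pn : 0 < n%:R :> R by rewrite ltr0n.
have [q0|q_gt0] := posnP q.
  (* Here [n = s < K]: the empty sum at [q = 0] drops out and [G_k(n) = G_0(1)]. *)
  exists 1%N => //; rewrite -(ler_pM2l pn) gE {}nE q0 /gain_sum.
  by rewrite big_geq// !mulr0 !add0r mul1r mulr1.
have K0 : 0 <= (K - s)%:R * q%:R :> R by rewrite mulr_ge0.
have s0 : 0 <= s%:R * q.+1%:R :> R by rewrite mulr_ge0.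
case/orP: (le_total (gain R u (fun=> 0%N) q) (gain R u (fun=> 0%N) q.+1)) => le_g.
  exists q.+1 => //; rewrite -(ler_pM2l pn) gE {}nE sumE// mulrDl ![_ * (_ * gain _ _ _ _)]mulrA.
  by rewrite lerD2r ler_wpM2l.
exists q => //; rewrite -(ler_pM2l pn) gE {}nE sumE// mulrDl ![_ * (_ * gain _ _ _ _)]mulrA.
by rewrite lerD2l ler_wpM2l.
Qed.

End Halton.

Theorem theorem1 (R : realType) (d : nat) (hd : (1 <= d)%N) (u : {set 'I_d})
    (hu : u != finset.set0) (k : 'I_d -> nat) :
  ereal_sup [set ((gain R u k n)%:E)%E | n in [set n : nat | (1 <= n)%N]] =
  ereal_sup [set ((gain R u (fun=> 0%N) n)%:E)%E | n in [set n : nat | (1 <= n)%N]].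
Proof.
apply/eqP; rewrite eq_le; apply/andP; split; apply: ge_ereal_sup => _ [n n_gt0 <-].
  have [m m_gt0 le_m] := gain_le_max R d u k n n_gt0.
  apply: le_ereal_sup_tmp; exists (gain R u (fun=> 0%N) m)%:E; last by rewrite lee_fin.
  by exists m.
(* Conversely, every value of [G_0] is itself a value of [G_k], taken at a multiple of the
   modulus. *)
apply: ereal_sup_ubound; exists (modulus d u k * n)%N; last by rewrite gain_modulus_mul.
by rewrite /= muln_gt0 modulus_gt0.
Qed.
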